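(* Consider the two-state pinching-antenna system described in the context, with pinching antennas (PAs) at $(x_k,0,h)$, $k=1,\dots,M$, user at $(x_m,y_m,0)$, and rectangular serving regions with left/right extents $L_k,R_k>0$. Let $\gamma_{\mathrm{thr}}>0$ be the SNR threshold, and put $$C=\frac{\eta P_t}{\sigma^2},\qquad C_{0,k}=C e^{-\alpha x_k},\qquad A_{0,k}=\frac{C_{0,k}}{\gamma_{\mathrm{thr}}}-h^2 .$$ Then the outage probability $P_o=\Pr\{\gamma\le\gamma_{\mathrm{thr}}\}$, where $\gamma$ is the SNR of the serving PA, equals $$P_o=\sum_{k=1}^{M}\left(\frac{L_k\,P_{l,k}(L_k)}{D_x}+\frac{R_k\,P_{l,k}(R_k)}{D_x}\right),$$ where, for $\Delta>0$, $P_{l,k}(\Delta)$ is given by the following cases (which agree wherever they overlap): (1) if $A_{0,k}\le 0$: $\;P_{l,k}(\Delta)=1$; (2) if $0\le A_{0,k}\le\min\left(\frac{D_y^2}{4},\Delta^2\right)$: $\;P_{l,k}(\Delta)=1-\frac{\pi A_{0,k}}{2D_y\Delta}$; (3) if $\Delta^2\le A_{0,k}\le\frac{D_y^2}{4}$: $\;P_{l,k}(\Delta)=1-\frac{A_{0,k}}{D_y\Delta}\arcsin\left(\frac{\Delta}{\sqrt{A_{0,k}}}\right)-\frac{\sqrt{A_{0,k}-\Delta^2}}{D_y}$; (4) if $\frac{D_y^2}{4}\le A_{0,k}\le\Delta^2$: $\;P_{l,k}(\Delta)=1-\frac{A_{0,k}}{D_y\Delta}\arcsin\left(\frac{D_y}{2\sqrt{A_{0,k}}}\right)-\frac{\sqrt{A_{0,k}-\frac{D_y^2}{4}}}{2\Delta}$;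 (5) if $\max\left(\Delta^2,\frac{D_y^2}{4}\right)\le A_{0,k}\le\Delta^2+\frac{D_y^2}{4}$: $$P_{l,k}(\Delta)=1-\frac{A_{0,k}}{D_y\Delta}\left(\arcsin\left(\frac{\Delta}{\sqrt{A_{0,k}}}\right)-\arcsin\left(\frac{\sqrt{4A_{0,k}-D_y^2}}{2\sqrt{A_{0,k}}}\right)\right)-\frac{1}{4\Delta}\sqrt{4A_{0,k}-D_y^2}-\frac{1}{D_y}\sqrt{A_{0,k}-\Delta^2};$$ (6) if $A_{0,k}\ge\Delta^2+\frac{D_y^2}{4}$: $\;P_{l,k}(\Delta)=0$.
   Context: Model. Let $D_x,D_y,h,\eta,P_t,\sigma^2>0$ and $\alpha\ge 0$ be real constants ($\eta$: reference path loss, $P_t$: transmit power, $\sigma^2$: noise variance, $\alpha$: waveguide attenuation coefficient), and let $M\ge1$ be an integer. A user is at the random point $(x_m,y_m,0)$, where $x_m$ is uniform on $[0,D_x]$, $y_m$ is uniform on $[-D_y/2,D_y/2]$, and $x_m,y_m$ are independent. A waveguide of length $D_x$ parallel to the $x$-axis at height $h$, fed at $(0,0,h)$, carries $M$ pinching antennas (PAs); the $k$-th is at $(x_k,0,h)$ with $x_k=\frac{2k-1}{2}\delta$, $\delta=D_x/M$, $k=1,\dots,M$. Exactly one PA is active at a time. If the $k$-th PA is active, the received SNR is $$\gamma^{(k)}=\frac{\eta P_t e^{-\alpha x_k}}{\sigma^2\left((x_m-x_k)^2+y_m^2+h^2\right)}.$$ Serving regions (rectangular model). The $k$-th PA serves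 the user exactly when the user lies in the rectangle $[x_k-L_k,\,x_k+R_k]\times[-D_y/2,D_y/2]$, where $L_k,R_k>0$ are given numbers (in general $L_k\ne R_k$) such that these rectangles tile the deployment area: $x_1-L_1=0$, $x_k+R_k=x_{k+1}-L_{k+1}$ for $1\le k<M$, and $x_M+R_M=D_x$ (shared boundaries have probability zero and are assigned arbitrarily). The SNR of the serving PA is $\gamma=\gamma^{(k)}$ when the user lies in the $k$-th rectangle. *)

(* Defs.v *)
From HB Require Import structures.
From mathcomp Require Import all_boot all_order all_algebra.
From mathcomp Require Import all_classical all_reals all_analysis.

Set Implicit Arguments.
Unset Strict Implicit.
Unset Printing Implicit Defensive.

Import Order.TTheory GRing.Theory Num.Theory.
Import numFieldNormedType.Exports.

Local Open Scope classical_set_scope.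
Local Open Scope ring_scope.

Section random_variables.
Context (d : measure_display) (T : measurableType d) (R : realType).
Variable P : probability T R.

Definition uniform_law (X : {RV P >-> R}) (a b : R) : Prop :=
  exists ab : a < b, forall U : set R, measurable U ->
    distribution P X U = uniform_prob ab U.

Definition independent_RV2 (X Y : {RV P >-> R}) : Prop :=
  forall U V : set R, measurable U -> measurable V ->
    P (X @^-1` U `&` Y @^-1` V) = (P (X @^-1` U) * P (Y @^-1` V))%E.

End random_variables.

Section pinching_antennas.
Context (R : realType).

(* Antennas are indexed by k = 1, ..., M; values at other k are junk. *)
Definition pa_pos (Dx : R) (M k : nat) : R :=
  (2 * k%:R - 1) / 2 * (Dx / M%:R).

Definition snr (eta Pt alpha sigma2 h xk xm ym : R) : R :=
  eta * Pt * expR (- (alpha * xk))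
    / (sigma2 * ((xm - xk) ^+ 2 + ym ^+ 2 + h ^+ 2)).

Definition deployment_area (Dx Dy : R) : set (R * R) :=
  `[0, Dx] `*` `[- (Dy / 2), Dy / 2].

Definition serving_rect (Dy xk Lk Rk : R) : set (R * R) :=
  `[xk - Lk, xk + Rk] `*` `[- (Dy / 2), Dy / 2].

(* The rectangles have full height, so tiling only constrains the abscissae. *)
Definition rects_tile (Dx : R) (M : nat) (x L Rr : nat -> R) : Prop :=
  [/\ x 1%N - L 1%N = 0,
      forall k, (1 <= k < M)%N -> x k + Rr k = x k.+1 - L k.+1
    & x M + Rr M = Dx].

Definition coef_C (eta Pt sigma2 : R) : R := eta * Pt / sigma2.

Definition coef_C0 (eta Pt alpha sigma2 xk : R) : R :=
  coef_C eta Pt sigma2 * expR (- (alpha * xk)).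

Definition coef_A0 (eta Pt alpha sigma2 h thr xk : R) : R :=
  coef_C0 eta Pt alpha sigma2 xk / thr - h ^+ 2.

(* p is a value of P_{l,k}(Delta) when A is A_{0,k}. The cases overlap on their
   boundaries, so this is a relation: p must match every case that applies. *)
Definition Pl_cases (Dy A Delta p : R) : Prop :=
  (A <= 0 -> p = 1) /\
  (0 <= A <= Num.min (Dy ^+ 2 / 4) (Delta ^+ 2) ->
    p = 1 - pi * A / (2 * Dy * Delta)) /\
  (Delta ^+ 2 <= A <= Dy ^+ 2 / 4 ->
    p = 1 - A / (Dy * Delta) * asin (Delta / Num.sqrt A)
          - Num.sqrt (A - Delta ^+ 2) / Dy) /\
  (Dy ^+ 2 / 4 <= A <= Delta ^+ 2 ->
    p = 1 - A / (Dy * Delta) * asin (Dy / (2 * Num.sqrt A))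
          - Num.sqrt (A - Dy ^+ 2 / 4) / (2 * Delta)) /\
  (Num.max (Delta ^+ 2) (Dy ^+ 2 / 4) <= A <= Delta ^+ 2 + Dy ^+ 2 / 4 ->
    p = 1 - A / (Dy * Delta)
              * (asin (Delta / Num.sqrt A)
                 - asin (Num.sqrt (4 * A - Dy ^+ 2) / (2 * Num.sqrt A)))
          - 1 / (4 * Delta) * Num.sqrt (4 * A - Dy ^+ 2)
          - 1 / Dy * Num.sqrt (A - Delta ^+ 2)) /\
  (Delta ^+ 2 + Dy ^+ 2 / 4 <= A -> p = 0).

End pinching_antennas.

(* Main.v *)
(* A point of the k-th rectangle is in outage exactly when it lies outside the
   disk of squared radius A = A_{0,k} centred at the antenna's foot, and the
   rectangle splits there into two parts of widths L_k and R_k. Put b = Dy / 2.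
   The slice of the disk at horizontal distance t has half-height
   min (b, sqrt (A - t^2)), so a part of width Delta has conditional outage
   probability 1 - G / (b Delta), where G is the integral over [0, Delta] of that
   half-height; the six cases are the positions of Delta relative to the
   breakpoints sqrt (A - b^2) and sqrt A of the integrand. The open rectangles
   carry the whole mass, and on them the serving antenna is determined, so the
   outage probability is the sum of the contributions of the rectangles. *)
Require Import Defs.
From HB Require Import structures.
From mathcomp Require Import all_boot all_order all_algebra.
From mathcomp Require Import all_classical all_reals all_analysis.
From mathcomp Require Import measurable_realfun ring lra.
Import Order.TTheory GRing.Theory Num.Theory.
Import numFieldNormedType.Exports.
Local Open Scope classical_set_scope.
Local Open Scope ring_scope.
Set Implicit Arguments.
Unset Strict Implicit.
Unset Printing Implicit Defensive.

(** * Arcsine identities and the area under a circular arc *)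

Section analysis.
Context (R : realType).
Implicit Types a b c r t x y A D : R.
Local Notation mu := (@lebesgue_measure R).

Lemma asin1 : asin 1 = pi / 2 :> R.
Proof.
rewrite -[in LHS](@sin_pihalf R) sinK// in_itv/= lexx andbT.
by rewrite -subr_ge0 opprK addr_ge0// divr_ge0// pi_ge0.
Qed.

Lemma asin0 : asin 0 = 0 :> R.
Proof.
rewrite -[in LHS](@sin0 R) sinK// in_itv/=.
by rewrite oppr_le0 andbb divr_ge0// pi_ge0.
Qed.

(** The left argument is [cos (asin x) = sin (pi / 2 - asin x)]. The sign of [x] is what puts
    [pi / 2 - asin x] in the range where [asin] inverts [sin]. *)
Lemma asin_sqrtB1sqr x : 0 <= x <= 1 ->
  asin (Num.sqrt (1 - x ^+ 2)) = pi / 2 - asin x.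
Proof.
move=> /andP[x0 x1].
have xN1 : -1 <= x <= 1 by rewrite x1 andbT (le_trans _ x0)// lerN10.
have asin_ge0 : 0 <= asin x.
  rewrite leNgt; apply/negP => ax0.
  have : sin (asin x) < sin 0.
    rewrite ltr_sin// in_itv/=; first by rewrite asin_geNpi2// asin_lepi2.
    by rewrite oppr_le0 andbb divr_ge0// pi_ge0.
  by rewrite asinK ?in_itv// sin0 ltNge x0.
rewrite -cos_asin//.
have -> : cos (asin x) = sin (pi / 2 - asin x).
  by rewrite sinB sin_pihalf cos_pihalf mul0r mul1r subr0.
have pi0 := @pi_ge0 R.
have := asin_lepi2 xN1.
by move=> ?; rewrite sinK// in_itv/=; apply/andP; split; lra.
Qed.

(** The endpoints matter, and differentiability of [asin] stops short of them. The map is therefore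
    treated as the inverse of the continuous function [x |-> r * sin x]. *)
Lemma within_continuous_asin_div r : 0 < r ->
  {within `[- r, r], continuous (fun t => asin (t / r))}.
Proof.
move=> r0.
pose f x := r * sin x.
have fK : {in `[- (pi / 2), pi / 2], cancel f (fun t => asin (t / r))}.
  by move=> x xpi; rewrite /f [r * _]mulrC mulfK ?gt_eqF// sinK.
have -> : - r = f (- (pi / 2)) by rewrite /f sinN sin_pihalf mulrN1.
have fr : f (pi / 2) = r by rewrite /f sin_pihalf mulr1.
rewrite -[X in `[_, X]%classic]fr.
apply: segment_can_le_continuous fK.
- by have := @pi_ge0 R; lra.
- apply: continuous_subspaceT => x.
  by apply: cvgM; [exact: cvg_cst|exact: continuous_sin].
Qed.

Lemma integral_itv_cc_split (f : R -> R) a c b : continuous f -> a <= c <= b ->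
  (\int[mu]_(x in `[a, b]) (f x)%:E =
   \int[mu]_(x in `[a, c]) (f x)%:E + \int[mu]_(x in `[c, b]) (f x)%:E)%E.
Proof.
move=> cf /andP[ac cb].
have mf (D : set R) : measurable_fun D (EFin \o f).
  apply/measurable_funTS/measurable_EFinP.
  exact: continuous_measurable_fun.
rewrite -(@integral_itv_obnd_cbnd _ c)//.
rewrite -integral_setU//=.
- by rewrite -itv_bndbnd_setU//= bnd_simp.
- exact: mf.
- apply/disj_set2P/seteqP; split => // x [] /=.
  by rewrite !in_itv/= => /andP[_ xc] /andP[]; rewrite ltNge xc.
Qed.

Lemma integral_itv_cc_cst (f : R -> R) a b y : a <= b ->
  {in `[a, b], forall x, f x = y} ->
  (\int[mu]_(x in `[a, b]) (f x)%:E = (y * (b - a))%:E)%E.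
Proof.
move=> ab fy.
rewrite (eq_integral (cst y%:E)); last first.
  by move=> x; rewrite inE/= => xab; rewrite fy.
rewrite integral_cst//= lebesgue_measure_itv/= lte_fin.
have [_|ba] := ltP a b; first by rewrite -EFinD -EFinM.
by rewrite (@le_anti _ _ a b) ?ab// subrr mulr0 mule0.
Qed.

(** For [0 <= t <= sqrt A], the area under the circle of radius [sqrt A] between abscissae [0] and
    [t]: a triangle plus a circular sector. *)
Definition arc_primitive A t : R :=
  (t * Num.sqrt (A - t ^+ 2) + A * asin (t / Num.sqrt A)) / 2.

Lemma continuous_arc A : continuous (fun t : R => Num.sqrt (A - t ^+ 2)).
Proof.
move=> t; apply: (@continuous_comp _ _ _ (fun t => A - t ^+ 2) Num.sqrt).
  by apply: cvgB; [exact: cvg_cst|exact: exprn_continuous].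
exact: sqrt_continuous.
Qed.

Lemma is_derive_arc_primitive A t : 0 < A -> - Num.sqrt A < t < Num.sqrt A ->
  is_derive t 1 (arc_primitive A) (Num.sqrt (A - t ^+ 2)).
Proof.
move=> A0 /andP[rt tr].
have r0 : 0 < Num.sqrt A by rewrite sqrtr_gt0.
have rA : Num.sqrt A ^+ 2 = A by rewrite sqr_sqrtr// ltW.
have tA : 0 < A - t ^+ 2.
  by rewrite -{1}rA subr_sqr mulr_gt0// ?subr_gt0// -ltrBlDl sub0r.
set s := Num.sqrt (A - t ^+ 2).
have s0 : 0 < s by rewrite sqrtr_gt0.
have sE : s ^+ 2 = A - t ^+ 2 by rewrite sqr_sqrtr// ltW.
set r := Num.sqrt A in rt tr r0 rA *.
have dsq : is_derive t 1 (fun t : R => A - t ^+ 2) (- (2 * t)).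
  by apply: is_derive_eq; rewrite /GRing.scale/=; ring.
have ds : is_derive t 1 (fun t : R => Num.sqrt (A - t ^+ 2)) ((2 * s)^-1 * - (2 * t)).
  exact: (@is_derive1_comp _ _ (fun t : R => A - t ^+ 2) _ _ _ (is_derive1_sqrt tA) dsq).
have dasin : is_derive t 1 (fun t : R => asin (t / r)) (s^-1).
  have dl : is_derive t 1 (fun t : R => t / r) r^-1.
    by apply: is_derive_eq; rewrite /GRing.scale/=; ring.
  have tr1 : -1 < t / r < 1.
    by rewrite ltr_pdivlMr// ltr_pdivrMr// mulN1r mul1r rt.
  have := @is_derive1_comp _ _ (fun t : R => t / r) _ _ _ (is_derive1_asin tr1) dl.
  have -> : 1 - (t / r) ^+ 2 = (s / r) ^+ 2.
    rewrite !expr_div_n sE.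
    by rewrite -[in X in X - _ = _](mulfV (lt0r_neq0 (exprn_gt0 2 r0))) rA; ring.
  rewrite sqrtr_sqr ger0_norm ?divr_ge0 ?ltW//.
  by rewrite invf_div mulrAC mulfV ?gt_eqF// mul1r.
rewrite /arc_primitive.
apply: is_derive_eq; rewrite /GRing.scale/= -/s -/r.
(* The derivative reads [(s - t^2 / s + A / s) / 2]; this form of [A] reduces it to [s]. *)
have AE : A = s ^+ 2 + t ^+ 2 by rewrite sE subrK.
rewrite [X in X / s]AE; field.
by rewrite gt_eqF.
Qed.

Lemma integral_arc A a b : 0 <= a -> a <= b -> b <= Num.sqrt A ->
  (\int[mu]_(t in `[a, b]) (Num.sqrt (A - t ^+ 2))%:E =
   (arc_primitive A b - arc_primitive A a)%:E)%E.
Proof.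
(* Once the degenerate interval is set aside, [a < b] forces [sqrt A], hence [A], to be positive. *)
move=> a0; rewrite le_eqVlt => /predU1P[<- _|ab br].
  by rewrite set_itv1 integral_set1 subrr.
have r0 : 0 < Num.sqrt A by rewrite (lt_le_trans _ br)// (le_lt_trans a0).
have A0 : 0 < A by rewrite -sqrtr_gt0.
have sub t : t \in `]a, b[ -> - Num.sqrt A < t < Num.sqrt A.
  by rewrite in_itv/= => /andP[at_ tb]; apply/andP; split; lra.
rewrite (@continuous_FTC2 _ _ (arc_primitive A))//.
- exact/continuous_subspaceT/continuous_arc.
- have cF : {within `[a, b], continuous (arc_primitive A)}.
    apply: (@continuous_subspaceW _ _ _ `[- Num.sqrt A, Num.sqrt A]).
      by move=> t/=; rewrite !in_itv/= => /andP[? ?]; apply/andP; split; lra.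
    move=> t; apply: cvgM; last exact: cvg_cst.
    apply: cvgD; last first.
      by apply: cvgM; [exact: cvg_cst|exact: within_continuous_asin_div].
    have := @continuous_subspaceT _ _ `[- Num.sqrt A, Num.sqrt A]
      (fun t : R => t * Num.sqrt (A - t ^+ 2)).
    apply => {}t; apply: cvgM; [exact: cvg_id|exact: continuous_arc].
  have /(continuous_within_itvP _ ab)[_ cFa cFb] := cF.
  split => // t /sub tr.
  by have [] := is_derive_arc_primitive A0 tr.
- move=> t /sub tr; rewrite derive1E.
  by have [_] := is_derive_arc_primitive A0 tr.
Qed.

End analysis.

(** * Integral of the capped half-height, and its agreement with the six cases *)

Section capped.
Context (R : realType).
Implicit Types a b c r t x y A D : R.
Local Notation mu := (@lebesgue_measure R).

Definition capped_arc A b t : R := Num.min b (Num.sqrt (A - t ^+ 2)).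

(* The cap b is active for t <= sqrt (A - b^2), and the integrand vanishes for
   t >= sqrt A. As Num.sqrt is 0 on negative numbers, these breakpoints, and
   hence the formula, remain correct for A < b^2 and for A <= 0. *)
Definition capped_area A b D : R :=
  b * Num.min D (Num.sqrt (A - b ^+ 2))
  + arc_primitive A (Num.min D (Num.sqrt A))
  - arc_primitive A (Num.min D (Num.sqrt (A - b ^+ 2))).

Lemma continuous_capped_arc A b : continuous (capped_arc A b).
Proof.
move=> t; apply: (@continuous_min _ _ (cst b) (fun t : R => Num.sqrt (A - t ^+ 2))).
  exact: cvg_cst.
exact: continuous_arc.
Qed.

Lemma le_sqr_sqrtr x : x <= Num.sqrt x ^+ 2.
Proof.
have [x0|/ltW x0] := leP 0 x; first by rewrite sqr_sqrtr.
by rewrite (le_trans x0)// sqr_ge0.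
Qed.

(** The integrand is [b] up to [q], the arc from [q] to [r], and [0] beyond. Truncating both
    breakpoints at [D] treats all positions of [D] at once, some pieces shrinking to a point. *)
Lemma integral_capped_arc A b D : 0 <= b -> 0 <= D ->
  (\int[mu]_(t in `[0%R, D]) (capped_arc A b t)%:E = (capped_area A b D)%:E)%E.
Proof.
move=> b0 D0.
rewrite /capped_area.
set q := Num.sqrt (A - b ^+ 2); set r := Num.sqrt A.
have q0 : 0 <= q by exact: sqrtr_ge0.
have r0 : 0 <= r by exact: sqrtr_ge0.
have qr : q <= r by apply: ler_wsqrtr; rewrite lerBlDr lerDl sqr_ge0.
have m00 : 0 <= Num.min D q by rewrite le_min D0.
have m01 : Num.min D q <= Num.min D r.
  by rewrite le_min ge_min lexx/= ge_min qr orbT.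
have m1D : Num.min D r <= D by rewrite ge_min lexx.
have cf := @continuous_capped_arc A b.
rewrite (@integral_itv_cc_split _ _ _ (Num.min D r))// ?m1D ?(le_trans m00)//.
rewrite (@integral_itv_cc_split _ _ _ (Num.min D q))// ?m00//.
have piece1 : (\int[mu]_(t in `[0%R, Num.min D q]) (capped_arc A b t)%:E =
    (b * Num.min D q)%:E)%E.
  (* [q > 0] is needed to know that [q ^+ 2] is [A - b ^+ 2]; otherwise the piece is a single
     point. *)
  have [qle0|q_gt0] := leP q 0.
    have -> : Num.min D q = 0.
      by apply: le_anti; rewrite m00 andbT ge_min qle0 orbT.
    by rewrite set_itv1 integral_set1 mulr0.
  rewrite (@integral_itv_cc_cst _ _ _ _ b) ?subr0// => t.
  rewrite in_itv/= le_min => /and3P[t0 _ tq]; apply/min_idPl.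
  rewrite -[leLHS]ger0_norm// -sqrtr_sqr ler_wsqrtr// lerBrDr -lerBrDl.
  rewrite -[leRHS]sqr_sqrtr; last by rewrite ltW// -sqrtr_gt0.
  by rewrite ler_pXn2r.
have piece2 : (\int[mu]_(t in `[Num.min D q, Num.min D r]) (capped_arc A b t)%:E =
  (arc_primitive A (Num.min D r) - arc_primitive A (Num.min D q))%:E)%E.
  rewrite -integral_arc//; last by rewrite ge_min lexx orbT.
  have [Dq|/ltW qD] := leP D q.
    have -> : Num.min D r = D by apply/min_idPl/(le_trans Dq).
    by rewrite set_itv1 !integral_set1.
  apply: eq_integral => t; rewrite inE/= in_itv/= => /andP[qt _].
  congr EFin; apply/min_idPr.
  rewrite -[leRHS]ger0_norm// -sqrtr_sqr ler_wsqrtr// lerBlDr -lerBlDl.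
  by rewrite (le_trans (le_sqr_sqrtr _))// ler_pXn2r// nnegrE (le_trans q0).
have piece3 : (\int[mu]_(t in `[Num.min D r, D]) (capped_arc A b t)%:E = 0)%E.
  have [Dr|/ltW rD] := leP D r; first by rewrite set_itv1 integral_set1.
  rewrite (@integral_itv_cc_cst _ _ _ _ 0) ?mul0r// => t.
  rewrite in_itv/= => /andP[rt _].
  rewrite /capped_arc ler0_sqrtr; first exact/min_idPr.
  rewrite subr_le0 (le_trans (le_sqr_sqrtr _))// ler_pXn2r// nnegrE.
  exact: le_trans rt.
by rewrite piece1 piece2 piece3 adde0 -EFinD addrA.
Qed.

(** Cutting at the centre [c] leaves two one-sided integrals; the left one is reflected, the right
    one translated. *)
Lemma integral_capped_arc_centered A b c Dl Dr : 0 <= b -> 0 <= Dl -> 0 <= Dr ->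
  (\int[mu]_(x in `[(c - Dl)%R, (c + Dr)%R]) (capped_arc A b (x - c))%:E =
   (capped_area A b Dl + capped_area A b Dr)%:E)%E.
Proof.
move=> b0 Dl0 Dr0.
have cf : continuous (fun x : R => capped_arc A b (x - c)).
  move=> x; apply: (@continuous_comp _ _ _ (fun x : R => x - c)); last exact: continuous_capped_arc.
  by apply: cvgB; [exact: cvg_id|exact: cvg_cst].
rewrite (@integral_itv_cc_split _ _ _ c)//; last first.
  by rewrite gerBl lerDl Dl0.
rewrite EFinD -!integral_capped_arc//; congr (_ + _)%E.
(* The reflection carries [[c - Dl, c]] onto [[0, Dl]], and the integrand depends on [x - c] only
   through its square. *)
- pose F (x : R) := c - x.
  have cF : continuous F by move=> x; apply: cvgB; [exact: cvg_cst|exact: cvg_id].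
  have dF x : is_derive x 1 F (-1).
    by apply: is_derive_eq; rewrite /GRing.scale/=; ring.
  have F'E : F^`()%classic = cst (-1).
    by apply/funext => x; rewrite derive1E; have [_] := dF x.
  have := @integration_by_substitution_decreasing _ F (capped_arc A b) (c - Dl) c.
  rewrite /F subrr subKr -/F => ->.
  + apply: eq_integral => x _; congr EFin.
    by rewrite F'E /= !fctE/= opprK mulr1 /F /capped_arc -(opprB x) sqrrN.
  + by rewrite gerBl.
  + by move=> x y _ _ xy; rewrite /F ltrD2l ltrN2.
  + by rewrite F'E => x _; exact: cvg_cst.
  + by rewrite F'E; apply: is_cvg_cst.
  + by rewrite F'E; apply: is_cvg_cst.
  + split; first by move=> x _; have [] := dF x.
    * exact/cvg_at_right_filter/cF.
    * exact/cvg_at_left_filter/cF.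
  + exact/continuous_subspaceT/continuous_capped_arc.
- pose F (x : R) := x - c.
  have cF : continuous F by move=> x; apply: cvgB; [exact: cvg_id|exact: cvg_cst].
  have dF x : is_derive x 1 F 1.
    by apply: is_derive_eq; rewrite /GRing.scale/=; ring.
  have F'E : F^`()%classic = cst 1.
    by apply/funext => x; rewrite derive1E; have [_] := dF x.
  have := @integration_by_substitution_increasing _ F (capped_arc A b) c (c + Dr).
  rewrite /F subrr [c + Dr]addrC addrK -/F => ->.
  + apply: eq_integral => x _; congr EFin.
    by rewrite F'E /= !fctE/= mulr1.
  + by rewrite lerDr.
  + by move=> x y _ _ xy; rewrite /F ltrD2r.
  + by rewrite F'E => x _; exact: cvg_cst.
  + by rewrite F'E; apply: is_cvg_cst.
  + by rewrite F'E; apply: is_cvg_cst.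
  + split; first by move=> x _; have [] := dF x.
    * exact/cvg_at_right_filter/cF.
    * exact/cvg_at_left_filter/cF.
  + exact/continuous_subspaceT/continuous_capped_arc.
Qed.

(** Each case fixes which argument attains each minimum in [capped_area]. One value satisfying all
    six also shows that they agree where they overlap. *)
Lemma Pl_cases_capped_area Dy A D : 0 < Dy -> 0 < D ->
  Pl_cases Dy A D (1 - capped_area A (Dy / 2) D / (Dy / 2 * D)).
Proof.
move=> Dy0 D0.
rewrite /capped_area.
have [b b0 DyE] : exists2 b : R, 0 < b & Dy = 2 * b.
  by exists (Dy / 2); [rewrite divr_gt0|rewrite mulrC divfK].
have -> : Dy / 2 = b by rewrite DyE mulrC mulKf.
have Dy4 : Dy ^+ 2 / 4 = b ^+ 2 by rewrite DyE; field.
rewrite /Pl_cases !Dy4.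
have D_ : D = Num.sqrt (D ^+ 2) by rewrite sqrtr_sqr ger0_norm// ltW.
have arc0 : arc_primitive A 0 = 0.
  by rewrite /arc_primitive !mul0r asin0 mulr0 addr0 mul0r.
have Dr : D ^+ 2 <= A -> Num.min D (Num.sqrt A) = D.
  by move=> DA; apply/min_idPl; rewrite [leLHS]D_ ler_wsqrtr.
have rD : A <= D ^+ 2 -> Num.min D (Num.sqrt A) = Num.sqrt A.
  by move=> DA; apply/min_idPr; rewrite [leRHS]D_ ler_wsqrtr.
(* The area of a quarter disk. *)
have arcr : 0 <= A -> arc_primitive A (Num.sqrt A) = pi * A / 4.
  rewrite le_eqVlt => /predU1P[<-|A0].
    by rewrite /arc_primitive sqrtr0 !mul0r addr0 mulr0 !mul0r.
  rewrite /arc_primitive sqr_sqrtr ?(ltW A0)// subrr sqrtr0 mulr0 add0r.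
  by rewrite divff ?gt_eqF ?sqrtr_gt0// asin1; field.
have q0 : A <= b ^+ 2 -> Num.min D (Num.sqrt (A - b ^+ 2)) = 0.
  by move=> Ab; rewrite ler0_sqrtr ?subr_le0//; apply/min_idPr/ltW.
have arcq : b ^+ 2 <= A -> arc_primitive A (Num.sqrt (A - b ^+ 2)) =
    (b * Num.sqrt (A - b ^+ 2)
     + A * asin (Num.sqrt (A - b ^+ 2) / Num.sqrt A)) / 2.
  move=> bA; rewrite /arc_primitive sqr_sqrtr ?subr_ge0//.
  by rewrite subKr [Num.sqrt (b ^+ 2)]sqrtr_sqr ger0_norm ?(ltW b0)// [b * _]mulrC.
have qD : A <= D ^+ 2 + b ^+ 2 ->
    Num.min D (Num.sqrt (A - b ^+ 2)) = Num.sqrt (A - b ^+ 2).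
  by move=> AD; apply/min_idPr; rewrite [leRHS]D_ ler_wsqrtr// lerBlDr.
have [Dn0 bn0] : D != 0 /\ b != 0 by rewrite !gt_eqF.
split.
  move=> A0; rewrite q0 ?(le_trans A0) ?sqr_ge0// rD ?(le_trans A0) ?sqr_ge0//.
  by rewrite ler0_sqrtr// arc0 mulr0 addr0 subrr mul0r subr0.
split.
  move=> /andP[A0]; rewrite le_min => /andP[Ab AD].
  rewrite q0// rD// arcr// arc0 DyE; field.
  by rewrite Dn0 bn0.
split.
  move=> /andP[AD Ab]; rewrite q0// Dr// arc0 DyE /arc_primitive; field.
  by rewrite Dn0 bn0.
split.
  move=> /andP[bA AD]; rewrite qD ?(le_trans AD) ?lerDl ?sqr_ge0//.
  have A0 : 0 < A by rewrite (lt_le_trans _ bA)// exprn_gt0.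
  have r0 : 0 < Num.sqrt A by rewrite sqrtr_gt0.
  rewrite rD// arcr ?ltW// arcq// DyE -mulf_div divff// mul1r.
  (* Case (4) is stated with the complementary angle; the resulting [pi / 2] cancels the quarter
     disk. *)
  have -> : Num.sqrt (A - b ^+ 2) / Num.sqrt A = Num.sqrt (1 - (b / Num.sqrt A) ^+ 2).
    rewrite expr_div_n sqr_sqrtr ?ltW//.
    have -> : 1 - b ^+ 2 / A = (A - b ^+ 2) / A by field; rewrite gt_eqF.
    by rewrite sqrtrM ?subr_ge0// sqrtrV// ltW.
  rewrite asin_sqrtB1sqr; last first.
    apply/andP; split; first by rewrite divr_ge0// ltW.
    rewrite ler_pdivrMr// mul1r -[leLHS]ger0_norm ?(ltW b0)//.
    by rewrite -sqrtr_sqr ler_wsqrtr.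
  field.
  by rewrite Dn0 bn0.
split.
  rewrite ge_max => /andP[/andP[DA bA] AD].
  rewrite qD// Dr// arcq// DyE.
  have A0 : 0 < A by rewrite (lt_le_trans _ bA)// exprn_gt0.
  have r0 : 0 < Num.sqrt A by rewrite sqrtr_gt0.
  have -> : Num.sqrt (4 * A - (2 * b) ^+ 2) = 2 * Num.sqrt (A - b ^+ 2).
    have -> : 4 * A - (2 * b) ^+ 2 = 2 ^+ 2 * (A - b ^+ 2) by ring.
    by rewrite sqrtrM ?sqr_ge0// sqrtr_sqr ger0_norm.
  rewrite -mulf_div divff// mul1r /arc_primitive; field.
  by rewrite Dn0 bn0.
(* The half-rectangle lies inside the disk: both minima are [D], the arc terms cancel, and the area
   is [b * D]. *)
move=> AD.
have DA : D ^+ 2 <= A by rewrite (le_trans _ AD)// lerDl sqr_ge0.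
have -> : Num.min D (Num.sqrt (A - b ^+ 2)) = D.
  by apply/min_idPl; rewrite [leLHS]D_ ler_wsqrtr// lerBrDr.
rewrite Dr//; field.
by rewrite Dn0 bn0.
Qed.

(** The six cases exhaust the real line: after [A <= 0], compare [A] with [D ^+ 2], [Dy ^+ 2 / 4]
    and their sum. *)
Lemma Pl_cases_unique Dy A D p q : Pl_cases Dy A D p -> Pl_cases Dy A D q -> p = q.
Proof.
move=> [p1 [p2 [p3 [p4 [p5 p6]]]]] [q1 [q2 [q3 [q4 [q5 q6]]]]].
have [A0|/ltW A0] := leP A 0; first by rewrite p1// q1.
have [AD|DA] := leP A (D ^+ 2); have [Ab|bA] := leP A (Dy ^+ 2 / 4).
- have H : 0 <= A <= Num.min (Dy ^+ 2 / 4) (D ^+ 2) by rewrite A0 le_min Ab.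
  by rewrite p2// q2.
- have H : Dy ^+ 2 / 4 <= A <= D ^+ 2 by rewrite AD ltW.
  by rewrite p4// q4.
- have H : D ^+ 2 <= A <= Dy ^+ 2 / 4 by rewrite Ab ltW.
  by rewrite p3// q3.
- have [AS|/ltW SA] := leP A (D ^+ 2 + Dy ^+ 2 / 4); last by rewrite p6// q6.
  have H : Num.max (D ^+ 2) (Dy ^+ 2 / 4) <= A <= D ^+ 2 + Dy ^+ 2 / 4.
    by rewrite AS ge_max !ltW.
  by rewrite p5// q5.
Qed.
End capped.


(** * Law of the user position and outage mass of one rectangle *)

Section law.
Context (R : realType).
Local Notation mu := (@lebesgue_measure R).

Lemma uniform_probE (a b : R) (ab : a < b) (U : set R) : measurable U -> U `<=` `[a, b] ->
  uniform_prob ab U = ((b - a)^-1%:E * mu U)%E.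
Proof.
move=> mU Uab; rewrite /uniform_prob (eq_integral (cst (b - a)^-1%:E)); last first.
  by move=> x; rewrite inE/= => /Uab/=; rewrite in_itv/= /uniform_pdf => ->.
by rewrite integral_cst.
Qed.

Context (d : measure_display) (T : measurableType d) (P : probability T R).
Context (X Y : {RV P >-> R}).

(* E is a set of pairs over measurableTypeR R, the type on which uniform_prob is
   a measure: it has the sigma-algebra of R but another display. *)
Lemma prob_uniform_pair (a b c e : R) (ab : a < b) (ce : c < e)
    (E : set (measurableTypeR R * measurableTypeR R)) :
  (forall U, measurable U -> distribution P X U = uniform_prob ab U) ->
  (forall U, measurable U -> distribution P Y U = uniform_prob ce U) ->
  independent_RV2 X Y -> measurable E ->
  P ((fun w => (X w, Y w)) @^-1` E) =
  ((b - a)^-1%:E * \int[mu]_(x in `[a, b]) uniform_prob ce (xsection E x))%E.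
Proof.
move=> PX PY XY mE.
have mX : measurable_fun setT (X : T -> measurableTypeR R).
  exact: (@measurable_funP _ _ _ _ setT X).
have mY : measurable_fun setT (Y : T -> measurableTypeR R).
  exact: (@measurable_funP _ _ _ _ setT Y).
have mXY := measurable_fun_pair mX mY.
(* Independence gives the joint law on products of sets; uniqueness of the product measure extends
   this to [E]. *)
have ZE : forall A B, measurable A -> measurable B ->
    distribution P (mfun_Sub (mem_set mXY)) (A `*` B) =
    (uniform_prob ab A * uniform_prob ce B)%E.
  move=> A B mA mB; rewrite -PX// -PY//; exact: XY.
have H := @product_measure_unique _ _ _ _ R (uniform_prob ab) (uniform_prob ce) _ ZE.
transitivity ((uniform_prob ab \x uniform_prob ce)%E E); first exact/esym/H.
rewrite /product_measure1 integral_uniform//.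
exact: (@measurable_fun_xsection _ _ _ _ _ (uniform_prob ce)).
Qed.

(** Outage on a vertical slice: an open interval of half-length [sqrt A] is removed, or everything
    if it exceeds [b]. For [A <= 0] nothing is removed, as [sqrt A] is then [0]. *)
Lemma uniform_prob_slice (b A : R) (bb : - b < b) :
  uniform_prob bb [set y | y \in `[- b, b] /\ A <= y ^+ 2] =
  (1 - Num.min b (Num.sqrt A) / b)%:E.
Proof.
have b0 : 0 < b by lra.
have [bA|Ab] := ltP (b ^+ 2) A.
  have -> : [set y | y \in `[- b, b] /\ A <= y ^+ 2] = set0.
    apply/seteqP; split => // y [/=]; rewrite in_itv/= => yb Ay.
    have : y ^+ 2 <= b ^+ 2.
      by rewrite -[y ^+ 2]real_normK ?num_real// ler_pXn2r ?nnegrE ?ler_norml// ltW.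
    by rewrite leNgt (lt_le_trans bA Ay).
  rewrite measure0 (_ : Num.min b _ = b) ?divff ?gt_eqF// ?subrr//.
  by apply/min_idPl; rewrite -[leLHS]ger0_norm ?(ltW b0)// -sqrtr_sqr ler_wsqrtr// ltW.
set s := Num.sqrt A.
have s0 : 0 <= s by exact: sqrtr_ge0.
have sb : s <= b by rewrite -[leRHS]ger0_norm ?(ltW b0)// -sqrtr_sqr ler_wsqrtr.
have -> : [set y | y \in `[- b, b] /\ A <= y ^+ 2] = `[- b, b] `\` `]- s, s[.
  apply/seteqP; split => y /=.
    move=> [yb Ay]; split => // ys.
    have : `|y| < s by rewrite ltr_norml; move: ys; rewrite in_itv.
    rewrite ltNge /s -sqrtr_sqr => /negP; apply.
    exact: ler_wsqrtr.
  move=> [yb ys]; split => //.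
  rewrite (le_trans (le_sqr_sqrtr _))// -[leRHS]real_normK ?num_real// ler_pXn2r// ?nnegrE//.
  by rewrite leNgt ltr_norml; apply/negP; move=> ?; apply: ys; rewrite in_itv.
rewrite (min_idPr sb) uniform_probE; last 2 first.
  exact: measurableD.
  exact: subDsetl.
rewrite measureD//=; last first.
  by rewrite lebesgue_measure_itv/= lte_fin bb -EFinD ltry.
rewrite setIidr; last first.
  by move=> y /=; rewrite !in_itv/= => /andP[? ?]; apply/andP; split; lra.
rewrite !lebesgue_measure_itv/= !lte_fin bb.
(* For [s = 0] the interval is empty and the default branch [0] still equals [2 * s]. *)
have -> : (if (- s < s)%R then s%:E - (- s)%R%:E else 0)%E = (2 * s)%:E.
  case: ifPn => [_|ss]; first by rewrite -EFinD; congr EFin; ring.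
  by congr EFin; lra.
rewrite -!EFinD -EFinM; congr EFin; field.
by rewrite !gt_eqF// subr_gt0.
Qed.

Lemma measurable_outside_disk (c A : R) :
  measurable [set z : measurableTypeR R * measurableTypeR R |
    A <= (z.1 - c) ^+ 2 + z.2 ^+ 2].
Proof.
pose f (z : measurableTypeR R * measurableTypeR R) : measurableTypeR R :=
  (z.1 - c) ^+ 2 + z.2 ^+ 2.
have mf : measurable_fun setT f.
  apply: measurable_funD; apply: measurable_funX => //.
  exact: measurable_funB.
have := mf measurableT `[A, +oo[%classic (measurable_itv _).
rewrite setTI; congr measurable.
by apply/seteqP; split => z /=; rewrite in_itv/= andbT.
Qed.

(** Fubini over the slice probabilities. The rectangle is open in the abscissa so that the
    rectangles of distinct antennas become disjoint. *)
Lemma prob_outside_disk_in_rect (a0 a1 b c Dl Dr A : R) (aa : a0 < a1) (bb : - b < b) :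
  (forall U, measurable U -> distribution P X U = uniform_prob aa U) ->
  (forall U, measurable U -> distribution P Y U = uniform_prob bb U) ->
  independent_RV2 X Y ->
  0 < Dl -> 0 < Dr -> a0 <= c - Dl -> c + Dr <= a1 ->
  let E : set (measurableTypeR R * measurableTypeR R) :=
    (`]c - Dl, c + Dr[ `*` `[- b, b]) `&`
    [set z | A <= (z.1 - c) ^+ 2 + z.2 ^+ 2] in
  measurable E /\
  P ((fun w => (X w, Y w)) @^-1` E) =
  (((Dl + Dr) - (capped_area A b Dl + capped_area A b Dr) / b) / (a1 - a0))%:E.
Proof.
move=> PX PY XY Dl0 Dr0 a0c ca1 E.
have b0 : 0 < b by lra.
have mE : measurable E.
  apply: measurableI; first exact: measurableX.
  exact: measurable_outside_disk.
split => //.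
rewrite (prob_uniform_pair PX PY XY mE).
rewrite [RHS]EFinM [RHS]muleC; congr (_ * _)%E.
pose g x : R := 1 - capped_arc A b (x - c) / b.
(* Slices over abscissae outside the open rectangle are empty, so the integrand is extended by zero
   there. *)
transitivity (\int[mu]_(x in `[a0, a1]) (((EFin \o g) \_ `](c - Dl)%R, (c + Dr)%R[) x))%E.
  apply: eq_integral => x _; rewrite patchE; case: ifPn => [|xI].
    rewrite inE/= => xI.
    rewrite /= /g /capped_arc -uniform_prob_slice; congr (uniform_prob _ _).
    apply/seteqP; split => y; rewrite /xsection/= inE/=.
      by move=> [[_ ?] /= ?]; split => //; rewrite lerBlDl.
    by move=> [? ?]; split => //=; rewrite -lerBlDl.
  have -> : xsection E x = set0; last exact: measure0.
  apply/seteqP; split => y //; rewrite /xsection/= inE/= => -[[xI' _] _].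
  by move: xI; rewrite notin_setE.
rewrite -integral_mkcondr setIidr; last first.
  by move=> x /=; rewrite !in_itv/= => /andP[? ?]; apply/andP; split; lra.
have cf : continuous (fun x : R => capped_arc A b (x - c)).
  move=> x; apply: (@continuous_comp _ _ _ (fun x : R => x - c)); last exact: continuous_capped_arc.
  by apply: cvgB; [exact: cvg_id|exact: cvg_cst].
have cg : continuous g.
  move=> x; apply: cvgB; first exact: cvg_cst.
  by apply: cvgM; [exact: cf|exact: cvg_cst].
(* Adding the null endpoints makes the domain compact, which gives integrability of continuous
   functions. *)
rewrite -(@integral_itv_bndoo _ _ _ _ true false); last first.
  apply/measurable_funTS/measurable_EFinP.
  exact: continuous_measurable_fun.
have itg (f : R -> R) : continuous f ->
    mu.-integrable `[c - Dl, c + Dr] (EFin \o f).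
  move=> cont_f; apply: continuous_compact_integrable.
    exact: segment_compact.
  exact: continuous_subspaceT.
rewrite integralB_EFin//=; last 2 first.
- by apply: itg => x; exact: cvg_cst.
- by apply: itg => x; apply: cvgM; [exact: cf|exact: cvg_cst].
under [X in (_ - X)%E]eq_integral do rewrite EFinM.
rewrite integralZr//; last exact: (itg _ cf).
rewrite integral_capped_arc_centered ?ltW// integral_cst//= mul1e.
rewrite lebesgue_measure_itv/= lte_fin (_ : c - Dl < c + Dr)%R; last by lra.
by rewrite -!EFinD; congr EFin; ring.
Qed.

End law.

(** The sets need not cover the space: total mass [1] makes the complement of their union null. This
    disposes of the shared boundaries. *)
Lemma measure_sum_setI (R : realType) (d : measure_display)
    (T : measurableType d) (P : probability T R) (n : nat) (F : nat -> set T)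
    (S : set T) :
  measurable S -> (forall k, (k < n)%N -> measurable (F k)) ->
  trivIset `I_n F -> (\sum_(k < n) P (F k) = 1)%E ->
  P S = (\sum_(k < n) P (S `&` F k))%E.
Proof.
move=> mS mF tF PF.
set U := \bigcup_(k in `I_n) F k.
have mU : measurable U.
  by apply: fin_bigcup_measurable => // k kn; exact: mF.
have PU : P U = 1%E by rewrite measure_fin_bigcup// -(fsbig_ord _ n (fun k => P (F k))).
have PSU : P (S `\` U) = 0%E.
  apply/eqP; rewrite eq_le measure_ge0 andbT.
  have <- : P (~` U) = 0%E by rewrite probability_setC// PU subee.
  apply: le_measure; rewrite ?inE//.
  - exact: measurableD.
  - exact: measurableC.
have -> : P S = (P (S `\` U) + P (S `&` U))%E by exact: measureDI.
rewrite PSU add0e /U setI_bigcupr measure_fin_bigcup//.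
- by rewrite -(fsbig_ord _ n (fun k => P (S `&` F k))).
- exact: trivIset_setIl.
- by move=> k kn; apply: measurableI => //; exact: mF.
Qed.

(** * The outage condition as a disk, and the geometry of the tiling *)

Section serving.
Context (R : realType).

Lemma snr_le (eta Pt alpha sigma2 h thr xk xm ym : R) :
  0 < sigma2 -> 0 < h -> 0 < thr ->
  (snr eta Pt alpha sigma2 h xk xm ym <= thr) =
  (coef_A0 eta Pt alpha sigma2 h thr xk <= (xm - xk) ^+ 2 + ym ^+ 2).
Proof.
move=> s0 h0 t0.
have D0 : 0 < (xm - xk) ^+ 2 + ym ^+ 2 + h ^+ 2.
  by rewrite ltr_wpDl ?exprn_gt0// addr_ge0// sqr_ge0.
rewrite /snr /coef_A0 /coef_C0 /coef_C ler_pdivrMr ?mulr_gt0// lerBlDr.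
rewrite ler_pdivrMr// [eta * Pt / sigma2 * _]mulrAC ler_pdivrMr//.
by congr (_ <= _); ring.
Qed.

Context (Dx : R) (M : nat) (x L Rr : nat -> R) (M_ge1 : (1 <= M)%N)
  (L_gt0 : forall k, (1 <= k <= M)%N -> 0 < L k)
  (Rr_gt0 : forall k, (1 <= k <= M)%N -> 0 < Rr k)
  (tile : rects_tile Dx M x L Rr).

(** The widths telescope from the left end [0]; at [n = M] this makes the rectangle probabilities
    sum to [1]. *)
Lemma rects_tile_sum n : (1 <= n <= M)%N ->
  \sum_(k < n) (L k.+1 + Rr k.+1) = x n + Rr n.
Proof.
have [t1 t2 _] := tile.
case: n => // n; elim: n => [_|n IHn nM]; first by rewrite big_ord1; move: t1; lra.
rewrite big_ord_recr/= IHn ?(ltnW nM)//.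
by have := t2 n.+1 nM; lra.
Qed.

(** Induction on [j]: neighbours share an edge, and each further rectangle adds a positive width. *)
Lemma rects_tile_ordered i j : (1 <= i)%N -> (i < j)%N -> (j <= M)%N ->
  x i + Rr i <= x j - L j.
Proof.
have [_ t2 _] := tile.
move=> i1; elim: j => // j IHj; rewrite ltnS leq_eqVlt => /predU1P[ij|ij] jM.
  by rewrite ij t2// jM andbT -ij.
have j1 : (1 <= j <= M)%N by rewrite (leq_trans i1 (ltnW ij)) ltnW.
rewrite (le_trans (IHj ij (ltnW jM)))// -t2 ?jM ?andbT; last by case/andP: j1.
by have := L_gt0 j1; have := Rr_gt0 j1; lra.
Qed.

Lemma rects_tile_bounds k : (1 <= k <= M)%N ->
  0 <= x k - L k /\ x k + Rr k <= Dx.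
Proof.
have [t1 _ t3] := tile.
move=> /andP[k1 kM]; split.
  move: k1; rewrite leq_eqVlt => /predU1P[<-|k1]; first by rewrite t1.
  have h1 : (1 <= 1 <= M)%N by [].
  have := rects_tile_ordered (leqnn 1) k1 kM.
  by have := L_gt0 h1; have := Rr_gt0 h1; lra.
move: kM; rewrite leq_eqVlt => /predU1P[->|kM]; first by rewrite t3.
have hM : (1 <= M <= M)%N by rewrite M_ge1 leqnn.
have := rects_tile_ordered k1 kM (leqnn M).
by have := L_gt0 hM; have := Rr_gt0 hM; lra.
Qed.

(** One membership is strict and the other weak: an interior point has only one possible server,
    however shared edges are assigned. *)
Lemma rects_tile_disjoint i j u : (1 <= i <= M)%N -> (1 <= j <= M)%N ->
  x i - L i < u < x i + Rr i -> x j - L j <= u <= x j + Rr j -> i = j.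
Proof.
move=> /andP[i1 iM] /andP[j1 jM] /andP[iu ui] /andP[ju uj].
have [ij|ji|//] := ltngtP i j; exfalso.
  by have := rects_tile_ordered i1 ij jM; lra.
by have := rects_tile_ordered j1 ji iM; lra.
Qed.

End serving.

(** * Summation of the outage mass over the antennas *)

Theorem proposition1 (R : realType)
  (Dx Dy h eta Pt sigma2 alpha thr : R) (M : nat)
  (Dx_gt0 : 0 < Dx) (Dy_gt0 : 0 < Dy) (h_gt0 : 0 < h) (eta_gt0 : 0 < eta)
  (Pt_gt0 : 0 < Pt) (sigma2_gt0 : 0 < sigma2) (alpha_ge0 : 0 <= alpha)
  (thr_gt0 : 0 < thr) (M_ge1 : (1 <= M)%N)
  (L Rr : nat -> R)
  (L_gt0 : forall k, (1 <= k <= M)%N -> 0 < L k)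
  (Rr_gt0 : forall k, (1 <= k <= M)%N -> 0 < Rr k)
  (tile : rects_tile Dx M (pa_pos Dx M) L Rr)
  (d : measure_display) (T : measurableType d) (P : probability T R)
  (xm ym : {RV P >-> R})
  (xm_unif : uniform_law xm 0 Dx)
  (ym_unif : uniform_law ym (- (Dy / 2)) (Dy / 2))
  (xm_ym_indep : independent_RV2 xm ym)
  (serving : {RV P >-> nat})
  (servingP : forall w : T, deployment_area Dx Dy (xm w, ym w) ->
     (1 <= serving w <= M)%N /\
     serving_rect Dy (pa_pos Dx M (serving w)) (L (serving w))
       (Rr (serving w)) (xm w, ym w)) :
  let A0 := fun k => coef_A0 eta Pt alpha sigma2 h thr (pa_pos Dx M k) in
  let gamma := fun w : T =>
    snr eta Pt alpha sigma2 h (pa_pos Dx M (serving w)) (xm w) (ym w) in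
  (forall (k : nat) (Delta : R), (1 <= k <= M)%N -> 0 < Delta ->
     exists! p : R, Pl_cases Dy (A0 k) Delta p) /\
  (forall Pl : nat -> R -> R,
     (forall (k : nat) (Delta : R), (1 <= k <= M)%N -> 0 < Delta ->
        Pl_cases Dy (A0 k) Delta (Pl k Delta)) ->
     P [set w | gamma w <= thr] =
       (\sum_(1 <= k < M.+1)
          (L k * Pl k (L k) / Dx + Rr k * Pl k (Rr k) / Dx))%:E).
Proof.
move=> A0 gamma; split.
  move=> k Delta _ D0; exists (1 - capped_area (A0 k) (Dy / 2) Delta / (Dy / 2 * Delta)).
  have H := Pl_cases_capped_area (A0 k) Dy_gt0 D0.
  by split => // p; exact: Pl_cases_unique.
move=> Pl PlP.
set x := pa_pos Dx M in servingP tile A0 gamma PlP *.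
pose b := Dy / 2.
have b0 : 0 < b by rewrite divr_gt0.
have [xx PX] := xm_unif; have [yy PY] := ym_unif.
pose Z w : measurableTypeR R * measurableTypeR R := (xm w, ym w).
pose F k := Z @^-1` (`]x k - L k, x k + Rr k[ `*` `[- b, b]).
have mZ : measurable_fun setT Z.
  apply: measurable_fun_pair; first exact: (@measurable_funP _ _ _ _ _ xm).
  exact: (@measurable_funP _ _ _ _ _ ym).
(* [A] is kept free: [A0 k] gives the outage mass, and [0] the mass of the whole rectangle because
   the disk condition is then vacuous. *)
have PFG k A : (1 <= k <= M)%N ->
  let E := F k `&` Z @^-1` [set z | A <= (z.1 - x k) ^+ 2 + z.2 ^+ 2] in
  measurable E /\ P E =
   (((L k + Rr k) - (capped_area A b (L k) + capped_area A b (Rr k)) / b) / Dx)%:E.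
  move=> kM.
  have [lo hi] := rects_tile_bounds M_ge1 L_gt0 Rr_gt0 tile kM.
  have [mE PE] := prob_outside_disk_in_rect A PX PY xm_ym_indep
    (L_gt0 _ kM) (Rr_gt0 _ kM) lo hi.
  split; last by rewrite -[in RHS](subr0 Dx); exact: PE.
  by have := mZ measurableT _ mE; rewrite setTI.
have FE k : F k = F k `&` Z @^-1` [set z | 0 <= (z.1 - x k) ^+ 2 + z.2 ^+ 2].
  by apply/esym/setIidPl => w _ /=; rewrite addr_ge0// sqr_ge0.
have mF k : (k < M)%N -> measurable (F k.+1).
  by move=> kM; rewrite FE; have [] := PFG k.+1 0 kM.
have PF k : (k < M)%N -> P (F k.+1) = ((L k.+1 + Rr k.+1) / Dx)%:E.
  move=> kM; rewrite FE; have [_ ->] := PFG k.+1 0 kM.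
  have area0 D : 0 < D -> capped_area 0 b D = 0.
    move=> D0; rewrite /capped_area sub0r sqrtr0 ler0_sqrtr ?oppr_le0 ?sqr_ge0//.
    by rewrite (min_idPr (ltW D0)) mulr0 add0r subrr.
  by rewrite !area0 ?L_gt0 ?Rr_gt0// addr0 mul0r subr0.
have servingF k w : (1 <= k <= M)%N -> F k w -> serving w = k.
  move=> kM [/= xw yw].
  have [lo hi] := rects_tile_bounds M_ge1 L_gt0 Rr_gt0 tile kM.
  have wD : deployment_area Dx Dy (xm w, ym w).
    split => //=; move: xw; rewrite !in_itv/= => /andP[? ?].
    by apply/andP; split; lra.
  have [sM [/= sw _]] := servingP w wD.
  apply/esym; apply: (rects_tile_disjoint L_gt0 Rr_gt0 tile kM sM (u := xm w)).
  - by move: xw; rewrite in_itv.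
  - by move: sw; rewrite in_itv.
have tF : trivIset `I_M (fun k => F k.+1).
  move=> i j iM jM [w [Fi Fj]].
  by have := servingF i.+1 w iM Fi; rewrite (servingF j.+1 w jM Fj) => -[].
have PF1 : (\sum_(k < M) P (F k.+1) = 1)%E.
  rewrite (eq_bigr (fun k : 'I_M => ((L k.+1 + Rr k.+1) / Dx)%:E)); last first.
    by move=> k _; exact: PF.
  rewrite sumEFin -mulr_suml.
  rewrite (rects_tile_sum tile) ?M_ge1 ?leqnn//.
  by have [_ _ ->] := tile; rewrite divff ?gt_eqF.
pose S := [set w | gamma w <= thr].
have SE w : S w <-> A0 (serving w) <= (xm w - x (serving w)) ^+ 2 + ym w ^+ 2.
  by rewrite /S/= /gamma snr_le.
have mS : measurable S.
  (* The union runs over all naturals, since [serving] may take any value when the user is outside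
     the deployment area. *)
  have -> : S = \bigcup_j (serving @^-1` [set j] `&`
      Z @^-1` [set z | A0 j <= (z.1 - x j) ^+ 2 + z.2 ^+ 2]).
    apply/seteqP; split => w.
      by move=> /SE Sw; exists (serving w).
    by move=> [j _ [/= sj]] ?; apply/SE; rewrite sj.
  apply: bigcupT_measurable => j; apply: measurableI.
    rewrite -[X in measurable X]setTI; exact: (@measurable_funP _ _ _ _ _ serving).
  have := mZ measurableT _ (measurable_outside_disk (x j) (A0 j)).
  by rewrite setTI.
rewrite (measure_sum_setI mS mF tF PF1) big_add1/= big_mkord -sumEFin.
apply: eq_bigr => k _.
have kM : (1 <= k.+1 <= M)%N by rewrite ltn_ord.
(* On [F k.+1] the server is [k.+1], so outage becomes the disk condition of that single antenna. *)
have -> : S `&` F k.+1 = F k.+1 `&`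
    Z @^-1` [set z | A0 k.+1 <= (z.1 - x k.+1) ^+ 2 + z.2 ^+ 2].
  apply/seteqP; split => w.
    by move=> [/SE Sw Fw]; split => //; move: Sw; rewrite (servingF _ _ kM Fw).
  by move=> [Fw Gw]; split => //; apply/SE; rewrite (servingF _ _ kM Fw).
have [_ ->] := PFG _ (A0 k.+1) kM.
have Dx0 : Dx != 0 by rewrite gt_eqF.
have PlE D : 0 < D -> Pl k.+1 D = 1 - capped_area (A0 k.+1) b D / (b * D).
  move=> D0; apply: Pl_cases_unique (PlP _ _ kM D0) _.
  exact: Pl_cases_capped_area.
congr EFin; rewrite !PlE ?L_gt0 ?Rr_gt0//; field.
by rewrite Dx0 !gt_eqF ?L_gt0 ?Rr_gt0.
Qed.
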